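(* Suppose $Q\succ0$, $R\succ0$, $\lambda_y>0$, and that $H_{\mathrm d}$ has full row rank with sufficiently large column number. Let $\Gamma,\mathcal{U},\mathcal{Y}$ be convex sets. Consider the bi-level problem $$\text{(B)}\qquad \min_{g,\ \sigma_y\in\Gamma,\ u\in\mathcal{U},\ y\in\mathcal{Y}}\ \|y\|_Q^2+\|u\|_R^2+\lambda_y\|\sigma_y\|_2^2\quad\text{subject to}\quad H^*g=\mathrm{col}(u_{\mathrm{ini}},\,y_{\mathrm{ini}}+\sigma_y,\,u,\,y),$$ where $H^*$ is the $\tilde H$-component of a solution of $$\min_{\tilde H,\,K}\ \|\tilde H-H_{\mathrm d}\|_F^2\quad\text{subject to}\quad \tilde Y_{\mathrm F}=K\,\mathrm{col}(U_{\mathrm P},Y_{\mathrm P},U_{\mathrm F}),\quad K=[\,K_{\mathrm p}\ \ K_{\mathrm f}\,],\ K_{\mathrm f}\in\mathcal{L},$$ and the single-level problem $$\text{(CD)}\qquad \min_{g,\ \sigma_y\in\Gamma,\ u\in\mathcal{U},\ y\in\mathcal{Y}}\ \|u\|_R^2+\|y\|_Q^2+\lambda_y\|\sigma_y\|_2^2+\lambda_g\|Q_{\mathrm c}\,g\|_2\quad\text{subject to}\quad \hat H g=\mathrm{col}(u_{\mathrm{ini}},\,y_{\mathrm{ini}}+\sigma_y,\,u,\,y).$$ Then for any $\lambda_g\ge0$, (CD) is a convex relaxation of (B), that is: 1) (CD) is a convex optimization problem; 2) any feasible $(\sigma_y,u,y)$ for (B) is feasible for (CD); 3) the optimal value of (CD)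 is smaller than or equal to that of (B).
   Context: Setting. $m,p,T_{\mathrm{ini}},N,T$ are positive integers, $L:=T_{\mathrm{ini}}+N<T$. $\mathrm{col}(\cdot)$ stacks vectors/matrices vertically. For a sequence $\omega=\mathrm{col}(\omega(1),\dots,\omega(T))$, $\mathcal{H}_L(\omega)$ is the block Hankel matrix with $L$ block rows and $T-L+1$ columns whose $j$-th column is $\mathrm{col}(\omega(j),\dots,\omega(j+L-1))$. Given data $u_{\mathrm d}\in\mathbb{R}^{mT}$, $y_{\mathrm d}\in\mathbb{R}^{pT}$, partition $\mathcal{H}_L(u_{\mathrm d})=\mathrm{col}(U_{\mathrm P},U_{\mathrm F})$ and $\mathcal{H}_L(y_{\mathrm d})=\mathrm{col}(Y_{\mathrm P},Y_{\mathrm F})$, where $U_{\mathrm P},Y_{\mathrm P}$ consist of the first $T_{\mathrm{ini}}$ block rows and $U_{\mathrm F},Y_{\mathrm F}$ of the last $N$ block rows. Put $H_{\mathrm d}:=\mathrm{col}(U_{\mathrm P},Y_{\mathrm P},U_{\mathrm F},Y_{\mathrm F})$. In the inner problem of (B), $\tilde H$ has the same size and block partition as $H_{\mathrm d}$, $\tilde Y_{\mathrm F}$ is its last block (corresponding to $Y_{\mathrm F}$), $U_{\mathrm P},Y_{\mathrm P},U_{\mathrm F}$ are the given data, $K_{\mathrm p}$ has $(m+p)T_{\mathrm{ini}}$ columns (acting on $\mathrm{col}(U_{\mathrm P},Y_{\mathrm P})$), $K_{\mathrm f}\in\mathbb{R}^{pN\times mN}$ acts on $U_{\mathrm F}$,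 and $\mathcal{L}$ is the set of block-lower-triangular matrices in $\mathbb{R}^{pN\times mN}$ with blocks of size $p\times m$ (blocks strictly above the block diagonal vanish). LQ factorization: $$H_{\mathrm d}=\begin{bmatrix}L_{11}&0&0\\L_{21}&L_{22}&0\\L_{31}&L_{32}&L_{33}\end{bmatrix}\begin{bmatrix}Q_1\\Q_2\\Q_3\end{bmatrix},$$ with block rows corresponding to $\mathrm{col}(U_{\mathrm P},Y_{\mathrm P})$, $U_{\mathrm F}$, $Y_{\mathrm F}$, where the first factor is square and lower triangular and $\mathrm{col}(Q_1,Q_2,Q_3)$ has orthonormal rows. $L_{32}^*$ denotes the lower-block-triangular part of $L_{32}\in\mathbb{R}^{pN\times mN}$ (blocks of size $p\times m$), and $L_{32}':=L_{32}-L_{32}^*$. Let $Q^*$ be a matrix with $mN$ orthonormal rows satisfying $Q^*Q_i^{\mathsf T}=0$ for $i=1,2,3$ (''sufficiently large column number'' of $H_{\mathrm d}$ means that such a $Q^*$ exists). Define $$\hat H=\begin{bmatrix}L_{11}&0&0&0\\L_{21}&L_{22}&0&0\\L_{31}&L_{32}^*&L_{33}&L_{32}'\end{bmatrix}\begin{bmatrix}Q_1\\Q_2\\Q_3\\Q^*\end{bmatrix},\qquad Q_{\mathrm c}:=\mathrm{col}(Q_3,Q^* ).$$ Vectors $u_{\mathrm{ini}}\in\mathbb{R}^{mT_{\mathrm{ini}}}$, $y_{\mathrm{ini}}\in\mathbb{R}^{pT_{\mathrm{ini}}}$ are given. Decision variables: $g\in\mathbb{R}^{T-L+1}$, $\sigma_y\in\mathbb{R}^{pT_{\mathrm{ini}}}$,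 $u\in\mathbb{R}^{mN}$, $y\in\mathbb{R}^{pN}$. $\|y\|_Q^2$ denotes $\sum_k y(k)^{\mathsf T}Qy(k)$ over the $N$ blocks $y(k)\in\mathbb{R}^p$ of $y$, similarly $\|u\|_R^2$. $\Gamma\subseteq\mathbb{R}^{pT_{\mathrm{ini}}}$, $\mathcal{U}\subseteq\mathbb{R}^m$, $\mathcal{Y}\subseteq\mathbb{R}^p$; by abuse of notation $u\in\mathcal{U}$ ($y\in\mathcal{Y}$) means that every block $u(k)\in\mathcal{U}$ ($y(k)\in\mathcal{Y}$). A triple $(\sigma_y,u,y)$ is called feasible for a problem if there is a $g$ such that $(g,\sigma_y,u,y)$ is feasible. *)

(* Defs.v *)
From HB Require Import structures.
From mathcomp Require Import all_boot all_order all_algebra.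
From mathcomp Require Import boolp classical_sets reals ereal convex.

Set Implicit Arguments.
Unset Strict Implicit.
Unset Printing Implicit Defensive.

Import Order.TTheory GRing.Theory Num.Theory.

Local Open Scope classical_set_scope.
Local Open Scope ring_scope.

(** * Optimization problems (minimization) *)

Record opt_problem (R : realType) (V : Type) := OptProblem {
  objective : V -> R ;
  feasible : set V
}.

(* Equal to +oo when the problem is infeasible. *)
Definition optimal_value (R : realType) (V : Type) (P : opt_problem R V) :
    \bar R :=
  ereal_inf [set (objective P x)%:E | x in feasible P].

Definition solution (R : realType) (V : Type) (P : opt_problem R V) (x : V) :
    Prop :=
  feasible P x /\ forall z, feasible P z -> objective P x <= objective P z.

Definition convex_problem (R : realType) (V : lmodType R)
    (P : opt_problem R V) : Prop :=
  @convex_set R V (feasible P) /\ @convex_function R V setT (objective P).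

(** * Matrices, stacked vectors *)

Definition posdef (R : realType) (q : nat) (S : 'M[R]_q) : Prop :=
  S^T = S /\ forall x : 'cV[R]_q, x != 0 -> 0 < (x^T *m S *m x) 0 0.

(* Squared Frobenius norm; for a column vector, the squared Euclidean norm.
   (The library's norm on matrices is the max norm.) *)
Definition sqnorm2 (R : realType) (a b : nat) (A : 'M[R]_(a, b)) : R :=
  \sum_(i < a) \sum_(j < b) A i j ^+ 2.

Definition norm2 (R : realType) (a : nat) (x : 'cV[R]_a) : R :=
  Num.sqrt (sqnorm2 x).

(* A stacked vector col(w(0), ..., w(n-1)) with blocks in R^q is an element of
   'cV_(n * q); entry i of block k sits at position k * q + i. *)
Lemma blk_subproof (n q : nat) (k : 'I_n) (i : 'I_q) : (k * q + i < n * q)%N.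
Proof.
apply: (@leq_trans (k.+1 * q)); last by rewrite leq_mul2r ltn_ord orbT.
by rewrite mulSn addnC ltn_add2r.
Qed.

Definition blk (R : realType) (n q : nat) (w : 'cV[R]_(n * q)) (k : 'I_n) :
    'cV[R]_q :=
  \col_(i < q) w (Ordinal (blk_subproof k i)) 0.

Definition blockwise (R : realType) (n q : nat) (S : set 'cV[R]_q)
    (w : 'cV[R]_(n * q)) : Prop :=
  forall k : 'I_n, S (blk w k).

Definition wsqnorm (R : realType) (n q : nat) (S : 'M[R]_q)
    (w : 'cV[R]_(n * q)) : R :=
  \sum_(k < n) ((blk w k)^T *m S *m blk w k) 0 0.

(* Row i (column j) of a matrix with n block rows of height q (n block columns
   of width q') belongs to the block row i %/ q (block column j %/ q'). *)
Definition blk_lower (R : realType) (n q q' : nat)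
    (A : 'M[R]_(n * q, n * q')) : Prop :=
  forall (i : 'I_(n * q)) (j : 'I_(n * q')), (i %/ q < j %/ q')%N -> A i j = 0.

Definition blk_lower_part (R : realType) (n q q' : nat)
    (A : 'M[R]_(n * q, n * q')) : 'M[R]_(n * q, n * q') :=
  \matrix_(i, j) (if (j %/ q' <= i %/ q)%N then A i j else 0).

Definition orthonormal_rows (R : realType) (a b : nat) (A : 'M[R]_(a, b)) :
    Prop :=
  A *m A^T = 1%:M.

(** * Data matrices *)

Lemma hankel_subproof (L T q : nat) (hL : (L <= T)%N)
  (r : 'I_(L * q)) (j : 'I_(T - L + 1)) : (j * q + r < T * q)%N.
Proof.
have hj : (j <= T - L)%N by rewrite -ltnS; apply: leq_trans (ltn_ord j) _; rewrite addn1.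
apply: (@leq_trans (j * q + L * q)); first by rewrite ltn_add2l ltn_ord.
by rewrite -mulnDl leq_mul2r -[X in (_ <= X)%N](subnK hL) leq_add2r hj orbT.
Qed.

(* Column j (counted from 0) is the window col(w(j), ..., w(j + L - 1)) of w,
   that is, the L * q consecutive entries of w that start at position j * q. *)
Definition hankel (R : realType) (L T q : nat) (hL : (L <= T)%N)
    (w : 'cV[R]_(T * q)) : 'M[R]_(L * q, T - L + 1) :=
  \matrix_(r, j) w (Ordinal (hankel_subproof hL r j)) 0.

(* The first Tini and the last N block rows. *)
Definition past (R : realType) (Tini N q c : nat)
    (H : 'M[R]_((Tini + N) * q, c)) : 'M[R]_(Tini * q, c) :=
  usubmx (castmx (mulnDl Tini N q, erefl c) H).

Definition future (R : realType) (Tini N q c : nat)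
    (H : 'M[R]_((Tini + N) * q, c)) : 'M[R]_(N * q, c) :=
  dsubmx (castmx (mulnDl Tini N q, erefl c) H).

Definition col4 (R : realType) (n1 n2 n3 n4 c : nat)
    (A1 : 'M[R]_(n1, c)) (A2 : 'M[R]_(n2, c))
    (A3 : 'M[R]_(n3, c)) (A4 : 'M[R]_(n4, c)) :
    'M[R]_(n1 + n2 + n3 + n4, c) :=
  col_mx (col_mx (col_mx A1 A2) A3) A4.

(** * The LQ factorization and the modified data matrix *)

(* H = [L11 0 0; L21 L22 0; L31 L32 L33] col(Q1, Q2, Q3). *)
Definition LQ_factorization (R : realType) (n1 n2 n3 c : nat)
    (H : 'M[R]_(n1 + n2 + n3, c))
    (L11 : 'M[R]_(n1, n1))
    (L21 : 'M[R]_(n2, n1)) (L22 : 'M[R]_(n2, n2))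
    (L31 : 'M[R]_(n3, n1)) (L32 : 'M[R]_(n3, n2)) (L33 : 'M[R]_(n3, n3))
    (Q1 : 'M[R]_(n1, c)) (Q2 : 'M[R]_(n2, c)) (Q3 : 'M[R]_(n3, c)) : Prop :=
  let Lf := block_mx (block_mx L11 0 L21 L22) 0 (row_mx L31 L32) L33 in
  let Qf := col_mx (col_mx Q1 Q2) Q3 in
  [/\ H = Lf *m Qf, is_trig_mx Lf & orthonormal_rows Qf].

(* [L11 0 0 0; L21 L22 0 0; L31 L32^* L33 L32'] col(Q1, Q2, Q3, Qs), where
   L32^* is the lower-block-triangular part of L32 and L32' = L32 - L32^*. *)
Definition hatH (R : realType) (n1 N m p c : nat)
    (L11 : 'M[R]_(n1, n1))
    (L21 : 'M[R]_(N * m, n1)) (L22 : 'M[R]_(N * m, N * m))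
    (L31 : 'M[R]_(N * p, n1)) (L32 : 'M[R]_(N * p, N * m))
    (L33 : 'M[R]_(N * p, N * p))
    (Q1 : 'M[R]_(n1, c)) (Q2 : 'M[R]_(N * m, c))
    (Q3 : 'M[R]_(N * p, c)) (Qs : 'M[R]_(N * m, c)) :
    'M[R]_(n1 + N * m + N * p, c) :=
  let L32s := blk_lower_part L32 in
  block_mx (block_mx L11 0 L21 L22) 0
           (row_mx L31 L32s) (row_mx L33 (L32 - L32s))
  *m col_mx (col_mx Q1 Q2) (col_mx Q3 Qs).

(** * The inner (identification) problem *)

(* Decision variable (Ht, K), where K = [Kp Kf]. *)
Definition inner_problem (R : realType) (Tini N m p c : nat)
    (UP : 'M[R]_(Tini * m, c)) (YP : 'M[R]_(Tini * p, c))
    (UF : 'M[R]_(N * m, c)) (YF : 'M[R]_(N * p, c)) :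
    opt_problem R ('M[R]_(Tini * m + Tini * p + N * m + N * p, c) *
                   'M[R]_(N * p, Tini * m + Tini * p + N * m)) :=
  {| objective := fun x => sqnorm2 (x.1 - col4 UP YP UF YF) ;
     feasible := [set x |
       dsubmx x.1 = x.2 *m col_mx (col_mx UP YP) UF /\
       blk_lower (rsubmx x.2)] |}.

(** * The predictive-control problems *)

(* The tuple (g, sigma_y, u, y). *)
Definition dvars (R : realType) (Tini N m p c : nat) : lmodType R :=
  ('cV[R]_c * 'cV[R]_(Tini * p) * 'cV[R]_(N * m) * 'cV[R]_(N * p))%type.

Definition admissible (R : realType) (Tini N m p c : nat)
    (Gam : set 'cV[R]_(Tini * p)) (U : set 'cV[R]_m) (Y : set 'cV[R]_p)
    (uini : 'cV[R]_(Tini * m)) (yini : 'cV[R]_(Tini * p))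
    (H : 'M[R]_(Tini * m + Tini * p + N * m + N * p, c)) :
    set (dvars R Tini N m p c) :=
  [set x | let: (g, s, u, y) := x in
    [/\ H *m g = col4 uini (yini + s) u y,
        Gam s, blockwise U u & blockwise Y y]].

(* The outer problem, for a given matrix Hs. *)
Definition problem_B (R : realType) (Tini N m p c : nat)
    (Qw : 'M[R]_p) (Rw : 'M[R]_m) (lam_y : R)
    (Gam : set 'cV[R]_(Tini * p)) (U : set 'cV[R]_m) (Y : set 'cV[R]_p)
    (uini : 'cV[R]_(Tini * m)) (yini : 'cV[R]_(Tini * p))
    (Hs : 'M[R]_(Tini * m + Tini * p + N * m + N * p, c)) :
    opt_problem R (dvars R Tini N m p c) :=
  {| objective := fun x => let: (g, s, u, y) := x in
       wsqnorm Qw y + wsqnorm Rw u + lam_y * sqnorm2 s ;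
     feasible := admissible Gam U Y uini yini Hs |}.

Definition problem_CD (R : realType) (Tini N m p c nc : nat)
    (Qw : 'M[R]_p) (Rw : 'M[R]_m) (lam_y lam_g : R)
    (Gam : set 'cV[R]_(Tini * p)) (U : set 'cV[R]_m) (Y : set 'cV[R]_p)
    (uini : 'cV[R]_(Tini * m)) (yini : 'cV[R]_(Tini * p))
    (Hh : 'M[R]_(Tini * m + Tini * p + N * m + N * p, c))
    (Qc : 'M[R]_(nc, c)) :
    opt_problem R (dvars R Tini N m p c) :=
  {| objective := fun x => let: (g, s, u, y) := x in
       wsqnorm Rw u + wsqnorm Qw y + lam_y * sqnorm2 s
       + lam_g * norm2 (Qc *m g) ;
     feasible := admissible Gam U Y uini yini Hh |}.

Definition feasible_triple (R : realType) (Tini N m p c : nat)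
    (P : opt_problem R (dvars R Tini N m p c))
    (s : 'cV[R]_(Tini * p)) (u : 'cV[R]_(N * m)) (y : 'cV[R]_(N * p)) : Prop :=
  exists g : 'cV[R]_c, feasible P (g, s, u, y).

(* Main.v *)
Require Import Defs.
From HB Require Import structures.
From mathcomp Require Import all_boot all_order all_algebra.
From mathcomp Require Import ring lra.
From mathcomp Require Import interval_inference.
From mathcomp Require Import boolp classical_sets reals ereal convex.

Set Implicit Arguments.
Unset Strict Implicit.
Unset Printing Implicit Defensive.

Import Order.TTheory GRing.Theory Num.Theory.

Local Open Scope classical_set_scope.
Local Open Scope ring_scope.

(** In the coordinates given by the orthonormal rows of the LQ factorization
    the inner problem decouples and has an explicit solution. Write
    [W = [L11 0; L21 L22]] and [Qt = col(Q1, Q2)], so that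
    [col(UP, YP, UF) = W Qt]. For a causal [K = [Kp Kf]] the prediction error
    is [K W Qt - YF = (K W - [L31 L32]) Qt - L33 Q3], and orthonormality turns
    its squared norm into
    [|Kp L11 + Kf L21 - L31|^2 + |Kf L22 - L32|^2 + |L33|^2].
    Since [Kf] and [L22] are block lower triangular, so is [Kf L22]; hence the
    second term is at least [|L32'|^2], with equality only for
    [Kf L22 = L32^*]. Full row rank makes [W] invertible, and
    [K = [L31 L32^*] W^-1] attains all the bounds; it is causal because
    multiplication by an invertible lower triangular matrix also reflects
    block lower triangularity (blk_lower_trig_cancel). The identified matrix is
    therefore unique (inner_solutionE):
    [H^* = col(W, [L31 L32^*]) Qt].

    The matrix [hatH] differs from [H^*] only by terms [L33 Q3] and [L32' Qs],
    and the rows of [Qc = col(Q3, Qs)] are orthogonal to those of [Qt].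
    Replacing [g] by its projection [Qt^T Qt g] thus does not change [H^* g],
    annihilates [Qc g], and makes [hatH g] equal to [H^* g] (hatH_proj). So every
    feasible point of (B) yields a feasible point of (CD) with the same
    [sigma_y], [u], [y], zero regularization, and hence the same cost, which
    gives both the inclusion of feasible triples and the comparison of optimal
    values.

    Convexity of (CD) holds because its constraints are affine or blockwise in
    convex sets, and its cost is a nonnegative combination of positive definite
    quadratic forms and a Euclidean norm (problem_CD_convex). *)

(** * Frobenius and Euclidean norms *)

Section Frobenius.
Variable R : realType.

(** The trace form lets block decompositions and orthonormality act through
    matrix algebra instead of through the entries. *)
Lemma sqnorm2E a b (A : 'M[R]_(a, b)) : sqnorm2 A = \tr (A *m A^T).
Proof.
rewrite /sqnorm2 /mxtrace; apply: eq_bigr => i _; rewrite mxE.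
by apply: eq_bigr => j _; rewrite mxE expr2.
Qed.

Lemma sqnorm2_ge0 a b (A : 'M[R]_(a, b)) : 0 <= sqnorm2 A.
Proof. by apply: sumr_ge0 => i _; apply: sumr_ge0 => j _; apply: sqr_ge0. Qed.

Lemma sqnorm2_eq0 a b (A : 'M[R]_(a, b)) : sqnorm2 A = 0 -> A = 0.
Proof.
move=> A0; apply/matrixP => i j; rewrite mxE; apply/eqP.
have row_ge0 k : 0 <= \sum_(j < b) A k j ^+ 2.
  by apply: sumr_ge0 => l _; apply: sqr_ge0.
have Ai : \sum_(j < b) A i j ^+ 2 = 0.
  exact: (psumr_eq0P (fun k _ => row_ge0 k) A0).
suff: A i j ^+ 2 = 0 by move=> /eqP; rewrite sqrf_eq0.
exact: (psumr_eq0P (fun l _ => sqr_ge0 (A i l)) Ai).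
Qed.

Lemma sqnorm2_0 a b : sqnorm2 (0 : 'M[R]_(a, b)) = 0.
Proof. by rewrite sqnorm2E mul0mx linear0. Qed.

Lemma sqnorm2N a b (A : 'M[R]_(a, b)) : sqnorm2 (- A) = sqnorm2 A.
Proof. by rewrite !sqnorm2E linearN/= mulNmx mulmxN opprK. Qed.

Lemma sqnorm2_col_mx a1 a2 b (A : 'M[R]_(a1, b)) (B : 'M[R]_(a2, b)) :
  sqnorm2 (col_mx A B) = sqnorm2 A + sqnorm2 B.
Proof. by rewrite !sqnorm2E tr_col_mx mul_col_row mxtrace_block. Qed.

Lemma sqnorm2_row_mx a b1 b2 (A : 'M[R]_(a, b1)) (B : 'M[R]_(a, b2)) :
  sqnorm2 (row_mx A B) = sqnorm2 A + sqnorm2 B.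
Proof. by rewrite !sqnorm2E tr_row_mx mul_row_col linearD. Qed.

Lemma sqnorm2_mul_orthonormal a b c (A : 'M[R]_(a, b)) (Q : 'M[R]_(b, c)) :
  orthonormal_rows Q -> sqnorm2 (A *m Q) = sqnorm2 A.
Proof.
by move=> QQ; rewrite !sqnorm2E trmx_mul mulmxA -[A *m Q *m _]mulmxA QQ mulmx1.
Qed.

Lemma norm2_0 a : norm2 (0 : 'cV[R]_a) = 0.
Proof. by rewrite /norm2 sqnorm2_0 sqrtr0. Qed.

Lemma norm2Z a (t : R) (x : 'cV[R]_a) :
  0 <= t -> norm2 (t *: x) = t * norm2 x.
Proof.
move=> t0; rewrite /norm2 (_ : sqnorm2 _ = t ^+ 2 * sqnorm2 x).
  by rewrite sqrtrM ?sqr_ge0// sqrtr_sqr ger0_norm.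
rewrite !sqnorm2E linearZ/= -scalemxAl -scalemxAr !linearZ/=.
by rewrite mulrA expr2.
Qed.

Lemma norm2_sqr a (x : 'cV[R]_a) : norm2 x ^+ 2 = sqnorm2 x.
Proof. by rewrite sqr_sqrtr// sqnorm2_ge0. Qed.

(** Both Cauchy-Schwarz and the triangle inequality are read off this expansion,
    with different coefficients. *)
Lemma sqnorm2_lin a b (s t : R) (A B : 'M[R]_(a, b)) :
  sqnorm2 (s *: A + t *: B) =
  s ^+ 2 * sqnorm2 A + t ^+ 2 * sqnorm2 B + s * t * (\tr (A *m B^T) *+ 2).
Proof.
have trC : \tr (B *m A^T) = \tr (A *m B^T).
  by rewrite -mxtrace_tr trmx_mul trmxK.
rewrite !sqnorm2E linearD/= !linearZ/= mulmxDl !mulmxDr !linearD/=.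
rewrite -!scalemxAl -!scalemxAr !linearZ/= trC.
by ring.
Qed.

(** The expansion of [| |y| x - |x| y |^2 >= 0] is
    [2 |x| |y| (|x| |y| - <x, y>) >= 0]; the factor [|x| |y|] can be cancelled
    unless one of the vectors vanishes. The inner product [<x, y>] is written
    as the trace of [x y^T]. *)
Lemma cauchy_schwarz_norm2 a (x y : 'cV[R]_a) :
  \tr (x *m y^T) <= norm2 x * norm2 y.
Proof.
have nx : 0 <= norm2 x := sqrtr_ge0 _.
have ny : 0 <= norm2 y := sqrtr_ge0 _.
have := sqnorm2_ge0 (norm2 y *: x + (- norm2 x) *: y).
rewrite sqnorm2_lin -!norm2_sqr.
have [x0|x_neq0] := eqVneq (norm2 x) 0.
  have -> : x = 0 by apply: sqnorm2_eq0; rewrite -norm2_sqr x0 expr0n.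
  by rewrite mul0mx linear0 mulr_ge0 ?sqrtr_ge0.
have [y0|y_neq0] := eqVneq (norm2 y) 0.
  have -> : y = 0 by apply: sqnorm2_eq0; rewrite -norm2_sqr y0 expr0n.
  by rewrite trmx0 mulmx0 linear0 mulr_ge0 ?sqrtr_ge0.
have xy_gt0 : 0 < norm2 x * norm2 y by rewrite mulr_gt0// lt0r ?x_neq0 ?y_neq0.
move=> h; rewrite -(ler_pM2l xy_gt0) -subr_ge0 -(pmulrn_lge0 _ (ltn0Sn 1)).
by apply: le_trans h _; rewrite le_eqVlt; apply/orP; left; apply/eqP; ring.
Qed.

Lemma ler_norm2D a (x y : 'cV[R]_a) : norm2 (x + y) <= norm2 x + norm2 y.
Proof.
have nx : 0 <= norm2 x := sqrtr_ge0 _.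
have ny : 0 <= norm2 y := sqrtr_ge0 _.
rewrite -(@ler_pXn2r _ 2)// ?nnegrE ?addr_ge0 ?sqrtr_ge0//.
have := sqnorm2_lin 1 1 x y; rewrite !scale1r norm2_sqr => ->.
by have := cauchy_schwarz_norm2 x y; rewrite -!norm2_sqr; nra.
Qed.

End Frobenius.

(** * Convexity of the predictive-control problem *)

Section Convexity.
Variable R : realType.

Lemma norm2_convex a (t : R) (x y : 'cV[R]_a) : 0 <= t -> t <= 1 ->
  norm2 (t *: x + (1 - t) *: y) <= t * norm2 x + (1 - t) * norm2 y.
Proof.
move=> t0 t1; apply: le_trans (ler_norm2D _ _) _.
by rewrite !norm2Z// subr_ge0.
Qed.

(** The defect of convexity of a quadratic form [f] is explicit:
    [t f(x) + (1 - t) f(y) - f(t x + (1 - t) y) = t (1 - t) f(x - y)]. *)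
Lemma posdef_form_convex q (S : 'M[R]_q) (t : R) (x y : 'cV[R]_q)
    (f := fun z : 'cV[R]_q => (z^T *m S *m z) 0 0) :
  posdef S -> 0 <= t -> t <= 1 ->
  f (t *: x + (1 - t) *: y) <= t * f x + (1 - t) * f y.
Proof.
move=> [_ S_gt0] t0 t1.
have f_ge0 z : 0 <= f z.
  have [->|/S_gt0/ltW//] := eqVneq z 0.
  by rewrite /f mulmx0 mxE.
pose d := t * (1 - t) * f (x - y).
suff -> : f (t *: x + (1 - t) *: y) = t * f x + (1 - t) * f y - d.
  by rewrite gerBl !mulr_ge0// subr_ge0.
have addE (A B : 'M[R]_1) : (A + B) 0 0 = A 0 0 + B 0 0 by rewrite mxE.
have oppE (A : 'M[R]_1) : (- A) 0 0 = - A 0 0 by rewrite mxE.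
have sclE k (A : 'M[R]_1) : (k *: A) 0 0 = k * A 0 0 by rewrite mxE.
have trZ k (z : 'cV[R]_q) : (k *: z)^T = k *: z^T by rewrite linearZ.
rewrite /d /f !(raddfD (@trmx R q 1)) !(raddfN (@trmx R q 1)) /= !trZ.
rewrite !(mulmxDl, mulmxDr, mulNmx, mulmxN).
rewrite !(=^~ scalemxAl, =^~ scalemxAr) !(addE, oppE, sclE).
by ring.
Qed.

Lemma sqnorm2_form q (x : 'cV[R]_q) : sqnorm2 x = (x^T *m 1%:M *m x) 0 0.
Proof.
rewrite mulmx1 mxE; apply: eq_bigr => i _.
by rewrite big_ord1 mxE expr2.
Qed.

Lemma posdef1 q : posdef (1%:M : 'M[R]_q).
Proof.
split=> [|x x0]; first exact: trmx1.
rewrite -sqnorm2_form lt0r sqnorm2_ge0 andbT.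
by apply: contra x0 => /eqP/sqnorm2_eq0 ->.
Qed.

Lemma sqnorm2_convex q (t : R) (x y : 'cV[R]_q) : 0 <= t -> t <= 1 ->
  sqnorm2 (t *: x + (1 - t) *: y) <= t * sqnorm2 x + (1 - t) * sqnorm2 y.
Proof.
by move=> t0 t1; rewrite !sqnorm2_form; apply: posdef_form_convex (posdef1 q) t0 t1.
Qed.

Lemma blk_lin n q (a b : R) (w z : 'cV[R]_(n * q)) k :
  blk (a *: w + b *: z) k = a *: blk w k + b *: blk z k.
Proof. by apply/colP => i; rewrite !mxE. Qed.

Lemma wsqnorm_convex n q (S : 'M[R]_q) (t : R) (x y : 'cV[R]_(n * q)) :
  posdef S -> 0 <= t -> t <= 1 ->
  wsqnorm S (t *: x + (1 - t) *: y) <= t * wsqnorm S x + (1 - t) * wsqnorm S y.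
Proof.
move=> S0 t0 t1; rewrite /wsqnorm !mulr_sumr -big_split/=.
by apply: ler_sum => k _; rewrite blk_lin; apply: posdef_form_convex.
Qed.

Lemma convex_set_comb (V : lmodType R) (A : set V) (t : {i01 R}) (x y : V) :
  @convex_set R V A -> A x -> A y -> A (t%:num *: x + (1 - t%:num) *: y).
Proof.
move=> cA Ax Ay; have := cA x y t (mem_set Ax) (mem_set Ay).
exact: set_mem.
Qed.

Lemma blockwise_convex n q (S : set 'cV[R]_q) (t : {i01 R})
    (x y : 'cV[R]_(n * q)) :
  convex_set S -> blockwise S x -> blockwise S y ->
  blockwise S (t%:num *: x + (1 - t%:num) *: y).
Proof. by move=> cS Sx Sy k; rewrite blk_lin; apply: convex_set_comb. Qed.

Lemma problem_CD_convex (Tini N m p c nc : nat)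
    (Qw : 'M[R]_p) (Rw : 'M[R]_m) (lam_y lam_g : R)
    (Gam : set 'cV[R]_(Tini * p)) (U : set 'cV[R]_m) (Y : set 'cV[R]_p)
    (uini : 'cV[R]_(Tini * m)) (yini : 'cV[R]_(Tini * p))
    (H : 'M[R]_(Tini * m + Tini * p + N * m + N * p, c)) (Qc : 'M[R]_(nc, c)) :
  posdef Qw -> posdef Rw -> 0 <= lam_y -> 0 <= lam_g ->
  convex_set Gam -> convex_set U -> convex_set Y ->
  convex_problem (problem_CD Qw Rw lam_y lam_g Gam U Y uini yini H Qc).
Proof.
move=> Q0 R0 ly lg cG cU cY; split.
- move=> [[[g s] u] y] [[[g' s'] u'] y'] t; rewrite !inE.
  case=> Hg Gs Uu Yy [Hg' Gs' Uu' Yy'].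
  (* The right-hand side is affine in the variables: the constant vectors
     uini and yini are their own convex combinations. *)
  have comb k (z : 'cV[R]_k) : z = t%:num *: z + (1 - t%:num) *: z.
    by rewrite -scalerDl addrC subrK scale1r.
  split.
  + rewrite linearD/= !linearZ/= Hg Hg' /col4 !scale_col_mx !add_col_mx.
    rewrite -(comb _ uini) !scalerDr addrACA.
    by congr (col_mx (col_mx (col_mx _ (_ + _)) _) _); rewrite -comb.
  + exact: convex_set_comb.
  + exact: blockwise_convex.
  + exact: blockwise_convex.
- move=> t [[[g s] u] y] [[[g' s'] u'] y'] _ _.
  have t0 : 0 <= t%:num by [].
  have t1 : t%:num <= 1 by [].
  rewrite convRE /= /unstable.onem.
  have hu := wsqnorm_convex u u' R0 t0 t1.
  have hy := wsqnorm_convex y y' Q0 t0 t1.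
  have hs := ler_wpM2l ly (sqnorm2_convex s s' t0 t1).
  have hg := ler_wpM2l lg (norm2_convex (Qc *m g) (Qc *m g') t0 t1).
  rewrite !scalemxAr -mulmxDr in hg.
  have := lerD (lerD (lerD hu hy) hs) hg.
  move/le_trans; apply.
  by rewrite le_eqVlt; apply/orP; left; apply/eqP; ring.
Qed.

End Convexity.

(** * Block lower triangular matrices *)

Section BlockTriangular.
Variable R : realType.

Lemma blk_lower_partP n q q' (A : 'M[R]_(n * q, n * q')) :
  blk_lower (blk_lower_part A).
Proof. by move=> i j ij; rewrite mxE leqNgt ij. Qed.

Lemma blk_lower_mul_trig n q q' (A : 'M[R]_(n * q, n * q'))
    (D : 'M[R]_(n * q')) :
  is_trig_mx D -> blk_lower A -> blk_lower (A *m D).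
Proof.
move=> /is_trig_mxP tD lA i j ij; rewrite mxE big1// => k _.
have [kj|jk] := ltnP k j; first by rewrite tD ?mulr0.
by rewrite lA ?mul0r//; apply: leq_trans ij _; apply: leq_div2r.
Qed.

(** By descending induction on the column [j]: when the entries of row [i] of
    [A] beyond column [j] vanish, entry [(i, j)] of [A D] reduces to
    [A i j * D j j], and the diagonal of [D] has no zero. This spares proving
    that the inverse of a triangular matrix is triangular. *)
Lemma blk_lower_trig_cancel n q q' (A : 'M[R]_(n * q, n * q'))
    (D : 'M[R]_(n * q')) :
  is_trig_mx D -> D \in unitmx -> blk_lower (A *m D) -> blk_lower A.
Proof.
move=> tD uD lAD i.
have Djj j : D j j != 0.
  move: uD; rewrite unitmxE det_trig// unitfE => /prodf_neq0; exact.
move/is_trig_mxP: tD => tD.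
suff H k (j : 'I_(n * q')) : (n * q' - j <= k)%N ->
    (i %/ q < j %/ q')%N -> A i j = 0.
  by move=> j; apply: H (leqnn _).
elim: k j => [|k IHk] j jk ij.
  by have := ltn_ord j; rewrite ltnNge -subn_eq0 -leqn0 jk.
have := lAD i j ij; rewrite mxE (bigD1 j)//= big1 => [|l lj].
  by rewrite addr0 => /eqP; rewrite mulf_eq0 (negPf (Djj j)) orbF => /eqP.
have [lt_lj|le_jl] := ltnP l j; first by rewrite tD ?mulr0.
rewrite IHk ?mul0r//; last by apply: leq_trans ij _; apply: leq_div2r.
have lt_jl : (j < l)%N by rewrite ltn_neqAle le_jl andbT eq_sym.
by rewrite -ltnS; apply: leq_trans jk; rewrite ltn_sub2l.
Qed.

(** Pythagoras: [A - blk_lower_part B] and [blk_lower_part B - B] have disjoint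
    supports. So [blk_lower_part B] is the unique best block lower triangular
    approximation of [B]. *)
Lemma sqnorm2_blk_lower_part n q q' (A B : 'M[R]_(n * q, n * q')) :
  blk_lower A ->
  sqnorm2 (A - B) =
  sqnorm2 (A - blk_lower_part B) + sqnorm2 (B - blk_lower_part B).
Proof.
move=> lA; rewrite /sqnorm2 -big_split; apply: eq_bigr => i _.
rewrite -big_split; apply: eq_bigr => j _ /=; rewrite !mxE.
case: leqP => ij; last by rewrite lA//; ring.
by ring.
Qed.

End BlockTriangular.

(** * The identified matrix *)

Section Inner.
Variable R : realType.

Lemma orthonormal_col_mx a1 a2 b (A1 : 'M[R]_(a1, b)) (A2 : 'M[R]_(a2, b)) :
  orthonormal_rows (col_mx A1 A2) ->
  [/\ orthonormal_rows A1, orthonormal_rows A2 & A2 *m A1^T = 0].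
Proof.
rewrite /orthonormal_rows tr_col_mx mul_col_row scalar_mx_block.
by move=> /eq_block_mx[].
Qed.

(** Full row rank of [H] forces the square factor to be invertible, and
    its block triangular shape passes this on to the diagonal blocks. *)
Lemma LQ_blocks n1 n2 n3 c (H : 'M[R]_(n1 + n2 + n3, c))
    L11 L21 L22 L31 L32 L33 Q1 Q2 Q3 :
  row_free H ->
  LQ_factorization H L11 L21 L22 L31 L32 L33 Q1 Q2 Q3 ->
  let W := block_mx L11 0 L21 L22 in
  let Qt := col_mx Q1 Q2 in
  [/\ H = col_mx (W *m Qt) (row_mx L31 L32 *m Qt + L33 *m Q3),
      is_trig_mx L22, L22 \in unitmx, W \in unitmx
    & orthonormal_rows (col_mx Qt Q3)].
Proof.
move=> fH [eH tL oQ] W Qt.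
move: tL; rewrite !is_trig_block_mx// => /and3P[_ /and3P[_ _ t22] _].
have : row_free (block_mx W 0 (row_mx L31 L32) L33).
  rewrite -row_leq_rank; apply: leq_trans (mxrankM_maxl _ (col_mx Qt Q3)).
  by rewrite -eH row_leq_rank.
rewrite row_free_unit unitmxE det_lblock unitrM => /andP[uW _].
have := uW; rewrite det_lblock unitrM => /andP[_ u22].
split; rewrite ?unitmxE//.
by rewrite eH mul_block_col mul0mx addr0.
Qed.

(** The least-squares problem restricted to causal predictors is solved by
    truncating [L32]. A minimizer is compared with the one whose predictor is
    [J = [L31 L32^*] W^-1]. *)
Lemma inner_solutionE Tini N m p c
    (UP : 'M[R]_(Tini * m, c)) (YP : 'M[R]_(Tini * p, c))
    (UF : 'M[R]_(N * m, c)) (YF : 'M[R]_(N * p, c))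
    L11 L21 L22 L31 L32 L33 Q1 Q2 Q3 Hs K :
  row_free (col4 UP YP UF YF) ->
  LQ_factorization (col4 UP YP UF YF) L11 L21 L22 L31 L32 L33 Q1 Q2 Q3 ->
  solution (inner_problem UP YP UF YF) (Hs, K) ->
  Hs = col_mx (block_mx L11 0 L21 L22) (row_mx L31 (blk_lower_part L32))
       *m col_mx Q1 Q2.
Proof.
move=> fH LQ [/= [HsK lK] opt].
have [eH t22 u22 uW oQ] := LQ_blocks fH LQ.
set W := block_mx L11 0 L21 L22 in eH uW *.
set Qt := col_mx Q1 Q2 in eH oQ *.
set P := row_mx L31 (blk_lower_part L32).
have [eP eY] := eq_col_mx eH.
have oQt : orthonormal_rows Qt by case: (orthonormal_col_mx oQ).
(* The part of the error that no causal predictor can remove. *)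
pose C := sqnorm2 (L32 - blk_lower_part L32) + sqnorm2 L33.
have objE (Z : 'M[R]_(_, c)) (J : 'M[R]_(N * p, _)) : blk_lower (rsubmx J) ->
    sqnorm2 (col_mx Z (J *m (W *m Qt)) - col4 UP YP UF YF) =
    sqnorm2 (Z - W *m Qt) + sqnorm2 (J *m W - P) + C.
  move=> lJ; rewrite eH opp_col_mx add_col_mx sqnorm2_col_mx -addrA.
  congr (_ + _).
  have -> : J *m (W *m Qt) - (row_mx L31 L32 *m Qt + L33 *m Q3) =
      row_mx (J *m W - row_mx L31 L32) (- L33) *m col_mx Qt Q3.
    by rewrite [RHS]mul_row_col mulNmx mulmxBl mulmxA opprD addrA.
  rewrite sqnorm2_mul_orthonormal// sqnorm2_row_mx sqnorm2N.
  have -> : J *m W = row_mx (lsubmx (J *m W)) (rsubmx J *m L22).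
    rewrite -[LHS]hsubmxK; congr row_mx.
    by rewrite -{1}[J]hsubmxK mul_row_block mulmx0 add0r row_mxKr.
  rewrite !opp_row_mx !add_row_mx !sqnorm2_row_mx.
  rewrite (sqnorm2_blk_lower_part _ (blk_lower_mul_trig t22 lJ)).
  by rewrite /C !addrA.
pose J := P *m invmx W.
have JW : J *m W = P by rewrite mulmxKV.
have lJ : blk_lower (rsubmx J).
  apply: blk_lower_trig_cancel t22 u22 _.
  have := JW; rewrite -[X in X *m W]hsubmxK mul_row_block mulmx0 add0r.
  move=> /eq_row_mx[_ ->]; exact: blk_lower_partP.
have := opt (col_mx (W *m Qt) (J *m (W *m Qt)), J).
rewrite /= col_mxKd eP => /(_ (conj erefl lJ)).
rewrite objE// -[Hs]vsubmxK HsK eP objE// JW !subrr !sqnorm2_0 !add0r.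
rewrite gerDr => le0.
have Z0 := sqnorm2_ge0 (usubmx Hs - W *m Qt).
have K0 := sqnorm2_ge0 (K *m W - P).
have /eqP := le_anti (introT andP (conj le0 (addr_ge0 Z0 K0))).
rewrite paddr_eq0// => /andP[/eqP/sqnorm2_eq0/subr0_eq ->].
move=> /eqP/sqnorm2_eq0/subr0_eq KW.
by rewrite mulmxA KW [RHS]mul_col_mx.
Qed.

(** The component of [g] orthogonal to the rows of [col(Q1, Q2)] is the only one
    seen by [col(Q3, Qs)]; dropping it makes [hatH] act as the identified
    matrix. *)
Lemma hatH_proj n1 N m p c
    L11 L21 L22 (L31 : 'M[R]_(N * p, n1)) (L32 : 'M[R]_(N * p, N * m)) L33
    (Q1 : 'M[R]_(n1, c)) Q2 Q3 Qs (g : 'cV[R]_c)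
    (Qt := col_mx Q1 Q2) (g' := Qt^T *m (Qt *m g)) :
  orthonormal_rows (col_mx Qt Q3) ->
  Qs *m Q1^T = 0 -> Qs *m Q2^T = 0 ->
  col_mx Q3 Qs *m g' = 0 /\
  hatH L11 L21 L22 L31 L32 L33 Q1 Q2 Q3 Qs *m g' =
  col_mx (block_mx L11 0 L21 L22) (row_mx L31 (blk_lower_part L32))
    *m Qt *m g.
Proof.
move=> /orthonormal_col_mx[oQt _ Q3t] Qs1 Qs2.
have Qc0 : col_mx Q3 Qs *m g' = 0.
  rewrite mulmxA mul_col_mx Q3t tr_col_mx mul_mx_row Qs1 Qs2.
  by rewrite row_mx0 col_mx0 mul0mx.
split=> //.
rewrite /hatH -mulmxA [X in _ *m X]mul_col_mx Qc0 -/Qt.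
have -> : Qt *m g' = Qt *m g by rewrite /g' mulmxA oQt mul1mx.
by rewrite mul_block_col !mulmx0 !addr0 -mul_col_mx mulmxA.
Qed.
End Inner.

(** * The convex relaxation *)

Theorem theorem3 (R : realType) (m p Tini N T : nat)
  (m_gt0 : (0 < m)%N) (p_gt0 : (0 < p)%N) (Tini_gt0 : (0 < Tini)%N)
  (N_gt0 : (0 < N)%N) (T_gt0 : (0 < T)%N) (LT : (Tini + N < T)%N)
  (ud : 'cV[R]_(T * m)) (yd : 'cV[R]_(T * p))
  (UP := past (hankel (ltnW LT) ud)) (UF := future (hankel (ltnW LT) ud))
  (YP := past (hankel (ltnW LT) yd)) (YF := future (hankel (ltnW LT) yd))
  (Hd := col4 UP YP UF YF)
  (c := (T - (Tini + N) + 1)%N) (n1 := (Tini * m + Tini * p)%N)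
  (L11 : 'M[R]_(n1, n1))
  (L21 : 'M[R]_(N * m, n1)) (L22 : 'M[R]_(N * m, N * m))
  (L31 : 'M[R]_(N * p, n1)) (L32 : 'M[R]_(N * p, N * m))
  (L33 : 'M[R]_(N * p, N * p))
  (Q1 : 'M[R]_(n1, c)) (Q2 : 'M[R]_(N * m, c)) (Q3 : 'M[R]_(N * p, c))
  (Qs : 'M[R]_(N * m, c))
  (uini : 'cV[R]_(Tini * m)) (yini : 'cV[R]_(Tini * p))
  (Qw : 'M[R]_p) (Rw : 'M[R]_m) (lam_y : R)
  (Gam : set 'cV[R]_(Tini * p)) (U : set 'cV[R]_m) (Y : set 'cV[R]_p) :
  posdef Qw -> posdef Rw -> 0 < lam_y ->
  row_free Hd ->
  LQ_factorization Hd L11 L21 L22 L31 L32 L33 Q1 Q2 Q3 ->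
  orthonormal_rows Qs ->
  Qs *m Q1^T = 0 -> Qs *m Q2^T = 0 -> Qs *m Q3^T = 0 ->
  convex_set Gam -> convex_set U -> convex_set Y ->
  forall lam_g : R, 0 <= lam_g ->
  let CD := problem_CD Qw Rw lam_y lam_g Gam U Y uini yini
              (hatH L11 L21 L22 L31 L32 L33 Q1 Q2 Q3 Qs) (col_mx Q3 Qs) in
  convex_problem CD /\
  forall (Hs : 'M[R]_(Tini * m + Tini * p + N * m + N * p, c))
         (K : 'M[R]_(N * p, Tini * m + Tini * p + N * m)),
    solution (inner_problem UP YP UF YF) (Hs, K) ->
    let B := problem_B Qw Rw lam_y Gam U Y uini yini Hs in
    (forall s u y, feasible_triple B s u y -> feasible_triple CD s u y) /\
    (optimal_value CD <= optimal_value B)%E.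
Proof.
move=> Q0 R0 ly fH LQ _ Qs1 Qs2 _ cG cU cY lam_g lg CD; split.
  by apply: problem_CD_convex => //; apply: ltW.
move=> Hs K solK B.
have HsE := inner_solutionE fH LQ solK.
have [_ _ _ _ oQ] := LQ_blocks fH LQ.
pose Qt := col_mx Q1 Q2.
pose proj (g : 'cV[R]_c) := Qt^T *m (Qt *m g).
have CD_proj g s u y : feasible B (g, s, u, y) ->
    feasible CD (proj g, s, u, y) /\
    objective CD (proj g, s, u, y) = objective B (g, s, u, y).
  move=> [/= Hg Gs Uu Yy].
  have [Qc0 hatHE] := hatH_proj L11 L21 L22 L31 L32 L33 g oQ Qs1 Qs2.
  split; first by split => //; rewrite hatHE -HsE.
  by rewrite /= Qc0 norm2_0 mulr0 addr0 [X in X + _]addrC.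
split=> [s u y [g /CD_proj[fg _]]|]; first by exists (proj g).
apply: le_ereal_inf_tmp => _ [[[[g s] u] y] /CD_proj[fg <-] <-].
by apply: ereal_inf_lbound; exists (proj g, s, u, y).
Qed.
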